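(* Let $S\subset T\subset\mathbb{R}^2$, with $|S|=2$ and $|T|=4$. Then $V_T(S)$ is not a cyclic quadrilateral.
   Context: For a finite nonempty set $T\subset\mathbb{R}^n$ and a nonempty proper subset $S\subset T$, the multipoint (higher order) Voronoi cell is $$V_T(S):=\left\{x\in\mathbb{R}^n : \max_{s\in S}\|x-s\|\le\min_{t\in T\setminus S}\|x-t\|\right\},$$ where $\|\cdot\|$ is the Euclidean norm. A (convex) quadrilateral is understood as a closed region: the convex hull of four points in the plane, each of which is an extreme point of that hull (so it has exactly four vertices). It is cyclic if its four vertices lie on a single circle. *)

(* Defs.v *)
From mathcomp Require Import all_boot all_order all_algebra finmap.
From mathcomp Require Import all_classical all_reals all_analysis.

Set Implicit Arguments.
Unset Strict Implicit.
Unset Printing Implicit Defensive.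

Import Order.TTheory GRing.Theory Num.Theory.

Local Open Scope classical_set_scope.
Local Open Scope ring_scope.

(* The library norm `|x| on 'rV[R]_n is the sup norm, hence this definition. *)
Definition euclidean_norm (R : realType) (n : nat) (x : 'rV[R]_n) : R :=
  Num.sqrt (\sum_(i < n) x 0 i ^+ 2).

(* The maximum and the minimum are taken in \bar R, so that they also have a
   value over an empty index set (-oo and +oo, respectively). *)
Definition voronoi_cell (R : realType) (n : nat) (T S : {fset 'rV[R]_n}) :
    set 'rV[R]_n :=
  [set x | (\big[maxe/-oo]_(s <- S) (euclidean_norm (x - s))%:E <=
            \big[mine/+oo]_(t <- (T `\` S)%fset) (euclidean_norm (x - t))%:E)%E].

Definition convex_hull (R : realType) (n : nat) (A : set 'rV[R]_n) :
    set 'rV[R]_n :=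
  smallest (@convex_set R 'rV[R]_n) A.

Definition extreme_point (R : realType) (n : nat) (A : set 'rV[R]_n)
    (x : 'rV[R]_n) : Prop :=
  A x /\
  forall (y z : 'rV[R]_n) (t : R), A y -> A z -> 0 < t < 1 ->
    x = t *: y + (1 - t) *: z -> y = x /\ z = x.

Definition quadrilateral (R : realType) (Q : set 'rV[R]_2) : Prop :=
  exists P : {fset 'rV[R]_2},
    [/\ #|` P| = 4%N,
        Q = convex_hull [set` P] &
        forall p, p \in P -> extreme_point Q p].

Definition circle (R : realType) (c : 'rV[R]_2) (r : R) : set 'rV[R]_2 :=
  [set x | euclidean_norm (x - c) = r].

Definition cyclic_quadrilateral (R : realType) (Q : set 'rV[R]_2) : Prop :=
  quadrilateral Q /\
  exists (c : 'rV[R]_2) (r : R), 0 < r /\ extreme_point Q `<=` circle c r.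

(* Main.v *)
(** Write S = {a, b} and T \ S = {c, d}. The cell is cut out by the four
    half-planes bounded by the bisectors of ac, ad, bd, bc. An extreme point
    lies on two nonparallel bisectors. It cannot lie on the bisectors of ac and
    bd (or of ad and bc): it would then lie on all four, and the cell would be a
    cone, with at most one extreme point. So the four vertices are the
    circumcentres of acd, abd, bcd, abc, and they form a quadrilateral whose
    sides are perpendicular to ac, ad, bd, bc. If it is cyclic, equality of
    directed angles at opposite vertices passes to a, d, b, c, which are thus
    concyclic; their circle's centre then lies on all four bisectors, which was
    excluded. *)
Require Import Defs.
From mathcomp Require Import all_boot all_order all_algebra finmap.
From mathcomp Require Import all_classical all_reals all_analysis.
From mathcomp Require Import ring lra.

Set Implicit Arguments.
Unset Strict Implicit.
Unset Printing Implicit Defensive.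

Import Order.TTheory GRing.Theory Num.Theory.

Local Open Scope ring_scope.

(** An injective map between finite sets of equal size is onto; here it sends [p] to the least [i]
    with [K i p]. It serves to match the four vertices with the four corners. *)
Lemma pigeonhole_onto (T : eqType) (s : seq T) (K : nat -> pred T) :
  uniq s -> (forall p, p \in s -> exists2 i, (i < size s)%N & K i p) ->
  (forall i p q, K i p -> K i q -> p = q) ->
  forall i, (i < size s)%N -> exists2 p, p \in s & K i p.
Proof.
move=> us sK Kinj i ilt.
pose f p := find (K^~ p) (iota 0 (size s)).
have fP p : p \in s -> (f p < size s)%N && K (f p) p.
  move=> /sK[j jlt Kjp].
  have hK : has (K^~ p) (iota 0 (size s)).
    by apply/hasP; exists j; rewrite ?mem_iota.
  have flt : (f p < size s)%N.
    by rewrite -[X in (_ < X)%N](size_iota 0) -has_find.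
  by rewrite flt; have := nth_find 0%N hK; rewrite nth_iota.
have uf : uniq (map f s).
  rewrite map_inj_in_uniq // => p q /fP/andP[_ Kp] /fP/andP[_ Kq] fpq.
  by apply: Kinj Kp _; rewrite fpq.
have sub : {subset map f s <= iota 0 (size s)}.
  by move=> _ /mapP[p /fP/andP[flt _] ->]; rewrite mem_iota.
have sz : (size (iota 0 (size s)) <= size (map f s))%N.
  by rewrite size_iota size_map.
have [_ fE] := uniq_min_size uf sub sz.
have : i \in map f s by rewrite fE mem_iota.
by case/mapP => p ps ->; exists p => //; case/andP: (fP _ ps).
Qed.

Section Plane.
Variable R : realType.
Implicit Types (a b c d o p q s t u v w x : 'rV[R]_2) (e : 'rV[R]_2 * 'rV[R]_2).

(** * Plane vectors, the incircle determinant and bisectors *)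

Definition dot u v : R := u 0 0 * v 0 0 + u 0 1 * v 0 1.
Definition cross u v : R := u 0 0 * v 0 1 - u 0 1 * v 0 0.
Definition rot90 u : 'rV[R]_2 := \row_j (if j == 0 then - u 0 1 else u 0 0).
Definition sqdist u v : R := dot (u - v) (u - v).
Definition area a b c : R := cross (b - a) (c - a).

Lemma rV2P u v : u 0 0 = v 0 0 -> u 0 1 = v 0 1 -> u = v.
Proof.
move=> h0 h1; apply/rowP => j.
by have [->|->] : j = 0 \/ j = 1
  by case: j => -[|[|//]] jlt; [left|right]; exact: val_inj.
Qed.

Lemma euclidean_normE u : euclidean_norm u = Num.sqrt (dot u u).
Proof.
rewrite /euclidean_norm !big_ord_recl big_ord0 addr0 /dot !expr2.
by rewrite (_ : lift ord0 ord0 = 1) //; exact: val_inj.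
Qed.

Lemma dot_ge0 u : 0 <= dot u u.
Proof. by rewrite addr_ge0 // -expr2 sqr_ge0. Qed.

Lemma dot_eq0 u : dot u u = 0 -> u = 0.
Proof.
move/eqP; rewrite /dot -!expr2 paddr_eq0 ?sqr_ge0 // !sqrf_eq0.
by move=> /andP[/eqP u0 /eqP u1]; apply: rV2P; rewrite mxE.
Qed.

Lemma orthogonal_rot90 u v : u != 0 -> dot u v = 0 ->
  exists k, v = k *: rot90 u.
Proof.
move=> u0 uv; have n0 : dot u u != 0 by apply: contra_neq u0; exact: dot_eq0.
exists (cross u v / dot u u); apply: rV2P; rewrite !mxE /=;
  move: n0 uv; rewrite /dot /cross => n0 uv.
- rewrite [LHS](_ : _ = (u 0 0 * (u 0 0 * v 0 0 + u 0 1 * v 0 1)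
      - u 0 1 * (u 0 0 * v 0 1 - u 0 1 * v 0 0))
      / (u 0 0 * u 0 0 + u 0 1 * u 0 1)); last by field.
  by rewrite uv; field.
- rewrite [LHS](_ : _ = (u 0 1 * (u 0 0 * v 0 0 + u 0 1 * v 0 1)
      + u 0 0 * (u 0 0 * v 0 1 - u 0 1 * v 0 0))
      / (u 0 0 * u 0 0 + u 0 1 * u 0 1)); last by field.
  by rewrite uv; field.
Qed.

Lemma independent_orthogonal_eq0 u v w :
  cross u v != 0 -> dot u w = 0 -> dot v w = 0 -> w = 0.
Proof.
move=> uv uw vw; apply: rV2P; rewrite mxE; apply: (mulfI uv); rewrite mulr0.
- transitivity (v 0 1 * dot u w - u 0 1 * dot v w);
    last by rewrite uw vw !mulr0 subrr.
  by rewrite /cross /dot; ring.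
- transitivity (u 0 0 * dot v w - v 0 0 * dot u w);
    last by rewrite uw vw !mulr0 subrr.
  by rewrite /cross /dot; ring.
Qed.

(* Vanishes exactly when the four points are concyclic or collinear: it compares
   the directed angles under which [p2 p4] is seen from [p1] and from [p3]. *)
Definition incircle p1 p2 p3 p4 : R :=
  cross (p2 - p1) (p4 - p1) * dot (p4 - p3) (p2 - p3) +
  dot (p2 - p1) (p4 - p1) * cross (p4 - p3) (p2 - p3).

(** Cofactor expansion along the column of squared distances. The origin [o] is free: at the centre
    of a circle through the points that column is constant. *)
Lemma incircleE o p1 p2 p3 p4 : incircle p1 p2 p3 p4 =
  sqdist o p1 * area p2 p3 p4 - sqdist o p2 * area p1 p3 p4 +
  sqdist o p3 * area p1 p2 p4 - sqdist o p4 * area p1 p2 p3.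
Proof. by rewrite /incircle /sqdist /area /cross /dot !mxE; ring. Qed.

Lemma area_alternating_sum p1 p2 p3 p4 :
  area p2 p3 p4 - area p1 p3 p4 + area p1 p2 p4 - area p1 p2 p3 = 0.
Proof. by rewrite /area /cross !mxE; ring. Qed.

Lemma concyclic_incircle_eq0 o k p1 p2 p3 p4 :
  sqdist p1 o = k -> sqdist p2 o = k -> sqdist p3 o = k -> sqdist p4 o = k ->
  incircle p1 p2 p3 p4 = 0.
Proof.
have sC x y : sqdist x y = sqdist y x by rewrite /sqdist /dot !mxE; ring.
rewrite !(sC _ o) (incircleE o) => -> -> -> ->.
by rewrite -!mulrBr -mulrDr -mulrBr area_alternating_sum mulr0.
Qed.

(** Affine in [x], as the quadratic terms cancel: zero on the bisector of [e.1] and [e.2], positive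
    strictly on the side of [e.1]. *)
Definition gap e x : R := sqdist x e.2 - sqdist x e.1.

Lemma gapD e x w : gap e (x + w) = gap e x - 2 * dot (e.2 - e.1) w.
Proof. by rewrite /gap /sqdist /dot !mxE; ring. Qed.

(** Both sides add the squared distances to [c] and [d] and subtract those to [a] and [b]. Hence
    three vanishing gaps force the fourth to vanish. *)
Lemma gap_exchange a b c d x :
  gap (a, c) x + gap (b, d) x = gap (a, d) x + gap (b, c) x.
Proof. by rewrite /gap /=; ring. Qed.

Lemma gap0_orthogonal e x y : gap e x = 0 -> gap e y = 0 ->
  dot (e.2 - e.1) (y - x) = 0.
Proof.
move=> x0; rewrite -{1}[y](subrKC x) gapD x0 sub0r => /eqP.
by rewrite oppr_eq0 mulf_eq0 pnatr_eq0 => /eqP.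
Qed.

(** * Extreme points of an intersection of half-planes *)

Definition cell (E : seq ('rV[R]_2 * 'rV[R]_2)) : set 'rV[R]_2 :=
  [set x | forall e, e \in E -> 0 <= gap e x]%classic.

Lemma extreme_point_segment (A : set 'rV[R]_2) p w : extreme_point A p ->
  A (p + w) -> A (p - w) -> w = 0.
Proof.
move=> [_ pext] Ap Am.
have [] := pext _ _ 2^-1 Ap Am; first by lra.
  by apply: rV2P; rewrite !mxE; field.
by move=> /eqP; rewrite -subr_eq0 addrAC subrr add0r => /eqP.
Qed.

(** Otherwise some [w != 0] is parallel to every boundary line through [p], and a short segment
    along [w] centred at [p] stays in the cell. *)
Lemma extreme_point_independent E p : extreme_point (cell E) p ->
  exists e f, [/\ e \in E, f \in E, gap e p = 0, gap f p = 0 &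
    cross (e.2 - e.1) (f.2 - f.1) != 0].
Proof.
move=> pext; apply: contrapT => nind.
have [w w0 wact] : exists2 w, w != 0 &
    forall e, e \in E -> gap e p = 0 -> dot (e.2 - e.1) w = 0.
  have [[e [eE ep e0]]|none] := pselect
      (exists e, [/\ e \in E, gap e p = 0 & e.2 - e.1 != 0]).
    exists (rot90 (e.2 - e.1)).
      apply: contra_neq e0 => /rowP r0; apply: rV2P.
        by have := r0 1; rewrite !mxE.
      by have /eqP := r0 0; rewrite !mxE /= oppr_eq0 => /eqP.
    move=> f fE fp; apply/eqP; apply: contrapT => /negP n0.
    apply: nind; exists e, f; split => //.
    by apply: contra_neq n0; rewrite /cross /dot /rot90 !mxE /= => <-; ring.
  exists (const_mx 1).
    by apply/eqP => /rowP/(_ 0)/eqP; rewrite !mxE oner_eq0.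
  move=> e eE ep; have [->|e0] := eqVneq (e.2 - e.1) 0.
    by rewrite /dot !mxE !mul0r addr0.
  by exfalso; apply: none; exists e.
(* Constraints active at [p] do not change along [w]; each of the others has positive slack and only
   bounds [k] from above, so a minimum over the list works. *)
have [k k0 kP] : exists2 k : R, 0 < k &
    forall e, e \in E -> `|2 * dot (e.2 - e.1) (k *: w)| <= gap e p.
  have dotZ (k : R) u : dot u (k *: w) = k * dot u w.
    by rewrite /dot !mxE; ring.
  have pin : forall e, e \in E -> 0 <= gap e p by case: pext.
  elim: E {pext nind} wact pin => [|e E IH] wact pin; first by exists 1.
  have [||k k0 kP] := IH.
  - by move=> f fE; apply: wact; rewrite inE fE orbT.
  - by move=> f fE; apply: pin; rewrite inE fE orbT.
  have eE : e \in e :: E by rewrite mem_head.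
  have [ep|ep] := eqVneq (gap e p) 0.
    exists k => // f; rewrite inE => /orP[/eqP->|/kP//].
    by rewrite dotZ wact // !mulr0 normr0 pin.
  have ep0 : 0 < gap e p by rewrite lt_def ep pin.
  (* The [+ 1] keeps the divisor positive even when [w] is orthogonal to the normal. *)
  pose m := 2 * `|dot (e.2 - e.1) w| + 1.
  have m0 : 0 < m by rewrite ltr_wpDl // mulr_ge0.
  have q0 : 0 < gap e p / m by rewrite divr_gt0.
  exists (Num.min k (gap e p / m)); first by rewrite lt_min k0.
  move=> f; rewrite inE => /orP[/eqP->|fE].
    rewrite dotZ !normrM gtr0_norm //
      (@gtr0_norm _ (Num.min _ _)) ?lt_min ?k0 //.
    rewrite mulrCA.
    apply: (@le_trans _ _ (gap e p / m * m)); last by rewrite divfK // gt_eqF.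
    apply: ler_pM; rewrite ?mulr_ge0 ?ge_min ?lexx ?orbT //.
      by rewrite le_min !ltW.
    by rewrite lerDl.
  apply: le_trans (kP f fE); rewrite !dotZ !normrM.
  rewrite (gtr0_norm k0) (@gtr0_norm _ (Num.min _ _)) ?lt_min ?k0 //.
  by rewrite ler_wpM2l // ler_wpM2r // ge_min lexx.
have : k *: w = 0.
  apply: extreme_point_segment pext _ _ => e eE.
  - by rewrite gapD subr_ge0 (le_trans (ler_norm _)) // kP.
  - rewrite gapD (_ : dot _ (- _) = - dot (e.2 - e.1) (k *: w)).
      rewrite mulrN opprK addrC -lerBlDr sub0r.
      by have := kP e eE; rewrite ler_norml => /andP[].
    by rewrite /dot !mxE; ring.
by move/eqP; rewrite scaler_eq0 (negPf w0) (gt_eqF k0).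
Qed.

(* A common zero makes the cell a cone with that apex. *)
Lemma common_zero_extreme E o p :
  (forall e, e \in E -> gap e o = 0) -> extreme_point (cell E) p -> p = o.
Proof.
move=> E0 pext; apply/eqP; rewrite -subr_eq0; apply/eqP.
(* With [w = p - o], the point [p - w] is the apex [o], and at [p + w] every gap is twice its value
   at [p]. *)
apply: (extreme_point_segment pext); last first.
  by move=> e eE; rewrite opprB subrKC E0.
move=> e eE; have := E0 _ eE; have := pext.1 _ eE.
by rewrite -[X in gap e X = 0](subrKC p) !gapD /dot !mxE; lra.
Qed.

(** * The circumcentres as vertices *)

Lemma concyclic_circumcentres a b c d v1 v2 v3 v4 o k :
  a != c -> a != d -> b != c -> b != d -> area a d c != 0 ->
  gap (a, c) v1 = 0 -> gap (a, d) v1 = 0 ->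
  gap (a, d) v2 = 0 -> gap (b, d) v2 = 0 ->
  gap (b, d) v3 = 0 -> gap (b, c) v3 = 0 ->
  gap (b, c) v4 = 0 -> gap (a, c) v4 = 0 ->
  sqdist v1 o = k -> sqdist v2 o = k -> sqdist v3 o = k -> sqdist v4 o = k ->
  exists x, [/\ gap (a, c) x = 0, gap (a, d) x = 0, gap (b, d) x = 0 &
    gap (b, c) x = 0].
Proof.
move=> ac ad bc bd adc ac1 ad1 ad2 bd2 bd3 bc3 bc4 ac4 k1 k2 k3 k4.
have dir s t x y : s != t -> gap (s, t) x = 0 -> gap (s, t) y = 0 ->
    exists m, y - x = m *: rot90 (t - s).
  move=> st x0 y0; apply: orthogonal_rot90; first by rewrite subr_eq0 eq_sym.
  exact: (gap0_orthogonal x0 y0).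
have [m12 e12] := dir _ _ _ _ ad ad1 ad2.
have [m14 e14] := dir _ _ _ _ ac ac1 ac4.
have [m34 e34] := dir _ _ _ _ bc bc3 bc4.
have [m32 e32] := dir _ _ _ _ bd bd3 bd2.
have := concyclic_incircle_eq0 k1 k2 k3 k4.
rewrite /incircle e12 e14 e34 e32.
(* Quarter turns preserve [cross] and [dot], so the determinant of the [v]s is that of [a], [d],
   [b], [c] times the four side multipliers. *)
have -> : forall u1 u2 u3 u4, cross (m12 *: rot90 u1) (m14 *: rot90 u2) *
    dot (m34 *: rot90 u3) (m32 *: rot90 u4) +
    dot (m12 *: rot90 u1) (m14 *: rot90 u2) *
    cross (m34 *: rot90 u3) (m32 *: rot90 u4) =
    m12 * m14 * m34 * m32 *
      (cross u1 u2 * dot u3 u4 + dot u1 u2 * cross u3 u4).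
  by move=> *; rewrite /cross /dot !mxE /=; ring.
rewrite -/(incircle a d b c).
(* A zero multiplier merges two neighbouring circumcentres into a point on three bisectors, and
   [gap_exchange] gives the fourth. *)
move/eqP; rewrite !mulf_eq0 -!orbA => /or4P[/eqP m0|/eqP m0|/eqP m0|].
- exists v1; have := gap_exchange a b c d v1; move: bd2.
  rewrite (_ : v2 = v1) => [-> |]; first by rewrite ac1 ad1 !add0r => <-; split.
  by apply/eqP; rewrite -subr_eq0 e12 m0 scale0r.
- exists v1; have := gap_exchange a b c d v1; move: bc4.
  rewrite (_ : v4 = v1) => [-> |]; first by rewrite ac1 ad1 !add0r => ->; split.
  by apply/eqP; rewrite -subr_eq0 e14 m0 scale0r.
- exists v3; have := gap_exchange a b c d v3; move: ac4.
  rewrite (_ : v4 = v3) => [-> |]; first by rewrite bd3 bc3 !addr0 => <-; split.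
  by apply/eqP; rewrite -subr_eq0 e34 m0 scale0r.
- case/orP => [/eqP m0|].
    exists v3; have := gap_exchange a b c d v3; move: ad2.
    rewrite (_ : v2 = v3) => [-> |].
      by rewrite bd3 bc3 !addr0 => ->; split.
    by apply/eqP; rewrite -subr_eq0 e32 m0 scale0r.
(* The centre v1 of the circle through a, c, d is the required point, since
   the incircle determinant reduces to the power of b times area a d c. *)
rewrite (incircleE v1) => /eqP I0; exists v1.
have bv : sqdist v1 b = sqdist v1 a.
  apply: (mulIf adc); move: ac1 ad1 I0; rewrite /gap /=.
  move=> /eqP; rewrite subr_eq0 => /eqP-> /eqP; rewrite subr_eq0 => /eqP->.
  by have := area_alternating_sum a d b c; nra.
by split=> //; rewrite /gap /= bv; [exact: ad1 | exact: ac1].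
Qed.

Lemma no_four_concyclic_extreme_points a b c d (P : seq 'rV[R]_2) o k :
  a != c -> a != d -> b != c -> b != d -> uniq P -> size P = 4%N ->
  (forall p, p \in P ->
    extreme_point (cell [:: (a, c); (a, d); (b, d); (b, c)]) p) ->
  (forall p, p \in P -> sqdist p o = k) -> False.
Proof.
move=> ac ad bc bd uP sP Pext Pcirc.
set E := [:: _; _; _; _] in Pext.
have no0 x : gap (a, c) x = 0 -> gap (a, d) x = 0 -> gap (b, d) x = 0 ->
    gap (b, c) x = 0 -> False.
  move=> x1 x2 x3 x4.
  have Px p : p \in P -> p = x.
    move=> /Pext; apply: common_zero_extreme => e.
    by rewrite !inE => /or4P[] /eqP->.
  case: P uP sP Px {Pext Pcirc} => [|p [|q P]] //= /andP[pq _] _ Px.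
  have px : p = x by apply: Px; rewrite mem_head.
  have qx : q = x by apply: Px; rewrite !inE eqxx orbT.
  by move: pq; rewrite px qx mem_head.
(* [E] lists the sides in cyclic order and [%% 4] closes the cycle; [K i p] puts [p] at the corner
   of sides [i] and [i.+1]. *)
pose nor e := e.2 - e.1; pose E_ i := nth (0, 0) E (i %% 4).
pose K i p := [&& gap (E_ i) p == 0, gap (E_ i.+1) p == 0 &
  cross (nor (E_ i)) (nor (E_ i.+1)) != 0].
have crossC u v : (cross u v != 0) = (cross v u != 0).
  by rewrite -oppr_eq0 (_ : - _ = cross v u) // /cross; ring.
have crossvv u : cross u u = 0 by rewrite /cross mulrC subrr.
have PK p : p \in P -> exists2 i, (i < size P)%N & K i p.
  move=> pP; have pext := Pext _ pP.
  (* Opposite sides meet only in a common zero, since the two sums of opposite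
     gaps agree and every gap is nonnegative on the cell. *)
  have nopp : ~ (gap (a, c) p = 0 /\ gap (b, d) p = 0) /\
      ~ (gap (a, d) p = 0 /\ gap (b, c) p = 0).
    have ge0 e : e \in E -> 0 <= gap e p by case: pext => + _; exact.
    have := gap_exchange a b c d p.
    have := ge0 (a, c); have := ge0 (a, d); have := ge0 (b, d).
    have := ge0 (b, c); rewrite !inE !eqxx !orbT.
    move=> /(_ isT) g4 /(_ isT) g3 /(_ isT) g2 /(_ isT) g1 g.
    by split=> -[h1 h2]; apply: (no0 p); lra.
  have [e [f [eE fE]]] := extreme_point_independent pext.
  rewrite sP; move: eE fE; rewrite !inE.
  (* Of the sixteen ordered pairs, equal sides have zero [cross], opposite sides contradict [nopp],
     and adjacent sides, in either order by [crossC], give a corner. *)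
  case/or4P => /eqP-> /or4P[] /eqP-> ep fp; rewrite ?crossvv ?eqxx // => ef;
    try (by case: nopp => n1 n2; (case: n1 + case: n2));
  by [ exists 0%N; rewrite // /K /E_ /nor /= ?ep ?fp ?eqxx // crossC
     | exists 1%N; rewrite // /K /E_ /nor /= ?ep ?fp ?eqxx // crossC
     | exists 2%N; rewrite // /K /E_ /nor /= ?ep ?fp ?eqxx // crossC
     | exists 3%N; rewrite // /K /E_ /nor /= ?ep ?fp ?eqxx // crossC ].
have Kinj i p q : K i p -> K i q -> p = q.
  move=> /and3P[/eqP p1 /eqP p2 ind] /and3P[/eqP q1 /eqP q2 _].
  apply/esym/eqP; rewrite -subr_eq0; apply/eqP.
  by apply: (independent_orthogonal_eq0 ind); exact: gap0_orthogonal.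
have onto i : (i < 4)%N -> exists2 p, p \in P & K i p.
  by rewrite -sP; exact: pigeonhole_onto.
have [v1 /Pcirc k1 /and3P[/eqP ac1 /eqP ad1 adc]] := onto 0%N isT.
have [v2 /Pcirc k2 /and3P[/eqP ad2 /eqP bd2 _]] := onto 1%N isT.
have [v3 /Pcirc k3 /and3P[/eqP bd3 /eqP bc3 _]] := onto 2%N isT.
have [v4 /Pcirc k4 /and3P[/eqP bc4 /eqP ac4 _]] := onto 3%N isT.
rewrite crossC in adc.
by have [x []] := concyclic_circumcentres ac ad bc bd adc
  ac1 ad1 ad2 bd2 bd3 bc3 bc4 ac4 k1 k2 k3 k4; exact: no0.
Qed.

(** * From the Voronoi cell to four half-planes *)

Lemma voronoi_cell_pair (T S : {fset 'rV[R]_2}) a b c d :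
  S = [:: a; b] :> seq _ -> (T `\` S)%fset = [:: c; d] :> seq _ ->
  voronoi_cell T S = cell [:: (a, c); (a, d); (b, d); (b, c)].
Proof.
move=> Sab Tcd; apply/funext => x; apply/propext.
rewrite /voronoi_cell /cell /mkset Sab Tcd !big_cons !big_nil.
rewrite !ge_max !le_min !leNye !leey !andbT !lee_fin.
have leE s t : (euclidean_norm (x - s) <= euclidean_norm (x - t)) =
    (0 <= gap (s, t) x).
  by rewrite !euclidean_normE ler_sqrt ?dot_ge0 // subr_ge0.
rewrite !leE; split=> [/andP[/andP[h1 h2] /andP[h3 h4]] e|h].
  by rewrite !inE => /or4P[] /eqP->.
by rewrite !h // !inE eqxx ?orbT.
Qed.

End Plane.

Theorem proposition3p5 (R : realType) (S T : {fset 'rV[R]_2}) :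
  (S `<=` T)%fset -> #|` S|%fset = 2%N -> #|` T|%fset = 4%N ->
  ~ cyclic_quadrilateral (voronoi_cell T S).
Proof.
move=> ST S2 T4 [[P [P4 _ Pext]] [ctr [r [r0 circ]]]].
have pair (A : {fset 'rV[R]_2}) : #|` A|%fset = 2%N ->
    exists a b, A = [:: a; b] :> seq _.
  by case: (enum_fset A) => [|a [|b []]] // _; exists a, b.
have [a [b Sab]] := pair _ S2.
have [c [d Tcd]] : exists c d, (T `\` S)%fset = [:: c; d] :> seq _.
  by apply: pair; rewrite cardfsDS // S2 T4.
have neq s t : s \in S -> t \in (T `\` S)%fset -> s != t.
  by move=> sS; rewrite in_fsetD => /andP[tS _]; apply: contraNneq tS => <-.
have inS s : (s \in S) = (s \in [:: a; b]) by rewrite -Sab.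
have inT t : (t \in (T `\` S)%fset) = (t \in [:: c; d]) by rewrite -Tcd.
rewrite (voronoi_cell_pair Sab Tcd) in Pext circ.
apply: (@no_four_concyclic_extreme_points R a b c d P ctr (r ^+ 2)) => //;
  first 4 last.
- exact: fset_uniq.
- move=> p pP; have := circ _ (Pext _ pP).
  by rewrite /circle /mkset euclidean_normE => <-; rewrite sqr_sqrtr ?dot_ge0.
all: by apply: neq; rewrite ?inS ?inT !inE eqxx ?orbT.
Qed.
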